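(* Let $\rho$ be a state on $\mathbb{C}^{d_A}\otimes\mathbb{C}^{d_B}$ with correlation matrix $R=(r_{ij})$, $r_{ij}=\operatorname{Tr}[\rho\,(F_i^A\otimes F_j^B)]$, and denote $r=\operatorname{rank}(R)$, $n_A=d_A^2-1$, $n_B=d_B^2-1$, $c_A=\sqrt{1-1/d_A}$, $c_B=\sqrt{1-1/d_B}$. Then $$\mathcal{E}(\rho)\ge\frac{1}{2\sqrt{r\,n_An_B}}\bigl(\|R\|_{\mathrm{Tr}}-c_Ac_B\bigr),$$ where $\|R\|_{\mathrm{Tr}}=\operatorname{Tr}\bigl(\sqrt{R^\dagger R}\bigr)$.
   Context: Let $\mathcal{H}_A=\mathbb{C}^{d_A}$, $\mathcal{H}_B=\mathbb{C}^{d_B}$, $\mathcal{H}_{AB}=\mathcal{H}_A\otimes\mathcal{H}_B$. Write $\mathcal{D}(\mathcal{H})$ for the density operators on $\mathcal{H}$, $\|\cdot\|_{op}$ for the operator norm, and $\mathcal{SEP}(\mathcal{H}_{AB})$ for the set of separable states (convex combinations of product states $\sigma_A\otimes\sigma_B$). Fix a family $\{F_i^A\}_{i=1}^{d_A^2-1}$ of traceless Hermitian $d_A\times d_A$ matrices with $\operatorname{Tr}(F_i^AF_j^A)=\delta_{ij}$ and $\|F_i^A\|_{op}\le1$, and similarly a family $\{F_j^B\}_{j=1}^{d_B^2-1}$ for $B$ (the same families are used to define both $R$ and $\mathcal{E}$). Let $\mathcal{K}_0=\{F_i^A\otimes I_B\}_i\cup\{I_A\otimes F_j^B\}_j$. On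 two copies $\mathcal{H}_{AB}^{(1)}\otimes\mathcal{H}_{AB}^{(2)}$ of $\mathcal{H}_{AB}$ define the cost operator $$C=\sum_{X\in\mathcal{K}_0}\bigl(X\otimes I_{AB}^{(2)}-I_{AB}^{(1)}\otimes X\bigr)^2 .$$ For $\rho,\sigma\in\mathcal{D}(\mathcal{H}_{AB})$ let $\Pi(\rho,\sigma)$ be the set of density operators on $\mathcal{H}_{AB}^{(1)}\otimes\mathcal{H}_{AB}^{(2)}$ with marginals $\rho$ and $\sigma$. The quantum Wasserstein distance of order 1 is $W_1(\rho,\sigma)=\bigl(\inf_{\tau\in\Pi(\rho,\sigma)}\operatorname{Tr}[C\tau]\bigr)^{1/2}$, and the Wasserstein entanglement measure is $$\mathcal{E}(\rho)=\inf_{\sigma\in\mathcal{SEP}(\mathcal{H}_{AB})}W_1(\rho,\sigma).$$ *)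

(* Defs.v *)
From HB Require Import structures.
From mathcomp Require Import all_boot all_order all_algebra.
From mathcomp Require Import sesquilinear spectral.
From mathcomp Require Import complex mxtens.
From mathcomp Require Import boolp classical_sets reals.

Set Implicit Arguments.
Unset Strict Implicit.
Unset Printing Implicit Defensive.

Import Order.TTheory GRing.Theory Num.Theory.

Local Open Scope classical_set_scope.
Local Open Scope sesquilinear_scope.
Local Open Scope complex_scope.
Local Open Scope ring_scope.

(* Operators on C^d are matrices 'M[R[i]]_d over the complex numbers R[i] built
   on a realType R.  C^m (x) C^n is C^(m * n), with the basis vector
   e_i (x) e_j at position mxtens_index (i, j); this is the convention of the
   Kronecker product tensmx, written *t. *)

Section Matrices.
Variable R : realType.
Local Notation C := R[i].

Definition l2norm n (x : 'cV[C]_n) : R :=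
  Num.sqrt (\sum_i Normc.normc (x i 0) ^+ 2).

Definition opnorm n (A : 'M[C]_n) : R :=
  sup [set l2norm (A *m x) | x in [set x : 'cV[C]_n | l2norm x <= 1]].

(* On R[i], 0 <= z means that z is real and nonnegative. *)
Definition psdmx n (A : 'M[C]_n) : Prop :=
  A \is hermsymmx /\ forall x : 'cV[C]_n, 0 <= (x ^t* *m A *m x) 0 0.

Definition density n (A : 'M[C]_n) : Prop := psdmx A /\ \tr A = 1.

(* Spectral functional calculus: a normal matrix A equals
   invmx P *m diag_mx D *m P with P = spectralmx A unitary and
   D = spectral_diag A. Only meaningful for A normal; the square root used here
   is that of a positive semidefinite matrix. *)
Definition sqrtmx n (A : 'M[C]_n) : 'M[C]_n :=
  invmx (spectralmx A) *m diag_mx (map_mx sqrtC (spectral_diag A))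
    *m spectralmx A.

(* The trace is a nonnegative real, so taking its real part loses nothing. *)
Definition trnorm m n (A : 'M[C]_(m, n)) : R :=
  complex.Re (\tr (sqrtmx (A ^t* *m A))).

Definition ptrace2 m n (T : 'M[C]_(m * n)) : 'M[C]_m :=
  \matrix_(i, j) \sum_(k < n) T (mxtens_index (i, k)) (mxtens_index (j, k)).

Definition ptrace1 m n (T : 'M[C]_(m * n)) : 'M[C]_n :=
  \matrix_(i, j) \sum_(k < m) T (mxtens_index (k, i)) (mxtens_index (k, j)).

Definition coupling n (rho sigma : 'M[C]_n) : set 'M[C]_(n * n) :=
  [set T | [/\ density T, ptrace2 T = rho & ptrace1 T = sigma]].

Definition separable dA dB : set 'M[C]_(dA * dB) :=
  [set sigma | exists (n : nat) (p : 'I_n -> R)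
      (sA : 'I_n -> 'M[C]_dA) (sB : 'I_n -> 'M[C]_dB),
    [/\ forall k, 0 <= p k, \sum_k p k = 1,
        forall k, density (sA k), forall k, density (sB k) &
        sigma = \sum_k (p k)%:C *: (sA k *t sB k)]].

Definition observable_family d (F : 'I_(d ^ 2 - 1) -> 'M[C]_d) : Prop :=
  [/\ forall k, F k \is hermsymmx, forall k, \tr (F k) = 0,
      forall k l, \tr (F k *m F l) = (k == l)%:R &
      forall k, opnorm (F k) <= 1].

Definition correlation_mx dA dB (FA : 'I_(dA ^ 2 - 1) -> 'M[C]_dA)
    (FB : 'I_(dB ^ 2 - 1) -> 'M[C]_dB) (rho : 'M[C]_(dA * dB)) :
    'M[C]_(dA ^ 2 - 1, dB ^ 2 - 1) :=
  \matrix_(k, l) \tr (rho *m (FA k *t FB l)).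

Definition sqdiff n (X : 'M[C]_n) : 'M[C]_(n * n) :=
  (X *t 1%:M - 1%:M *t X) *m (X *t 1%:M - 1%:M *t X).

(* The sum over the set { FA k (x) 1 } U { 1 (x) FB l }, written over indices:
   for observable families and dA, dB > 0 its elements are pairwise distinct. *)
Definition cost dA dB (FA : 'I_(dA ^ 2 - 1) -> 'M[C]_dA)
    (FB : 'I_(dB ^ 2 - 1) -> 'M[C]_dB) : 'M[C]_((dA * dB) * (dA * dB)) :=
  \sum_k sqdiff (FA k *t 1%:M) + \sum_l sqdiff (1%:M *t FB l).

(* Tr[C T] is a nonnegative real for every density matrix T. *)
Definition W1 dA dB (FA : 'I_(dA ^ 2 - 1) -> 'M[C]_dA)
    (FB : 'I_(dB ^ 2 - 1) -> 'M[C]_dB) (rho sigma : 'M[C]_(dA * dB)) : R :=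
  Num.sqrt (inf [set complex.Re (\tr (cost FA FB *m T))
                | T in coupling rho sigma]).

Definition wasserstein_ent dA dB (FA : 'I_(dA ^ 2 - 1) -> 'M[C]_dA)
    (FB : 'I_(dB ^ 2 - 1) -> 'M[C]_dB) (rho : 'M[C]_(dA * dB)) : R :=
  inf [set W1 FA FB rho sigma | sigma in @separable dA dB].

End Matrices.

(* Main.v *)
(* Let U be the partial isometry of the polar decomposition of the correlation
   matrix R, so that ||R||_Tr = Re Tr(U^* R), ||U||_F^2 <= rank R and U is a
   contraction.  Split R = S + (R - S) with S the correlation matrix of a
   separable sigma.  The Bloch vectors of states on A and B have norms at most
   c_A and c_B, so S is a convex combination of rank-one matrices a b with
   |a| |b| <= c_A c_B, whence Re Tr(U^* S) <= c_A c_B.  For the other term, let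
   tau be a coupling and put D(X) = X (x) 1 - 1 (x) X.  For commuting X and Y,
   D(XY) = D(X) (Y (x) 1) + D(Y) (1 (x) X), and Cauchy-Schwarz in the state tau
   bounds the (k, l) entry of R - S by sqrt a_k + sqrt b_l, where
   a_k = Tr[tau D(F_k^A)^2], b_l = Tr[tau D(F_l^B)^2] sum up to the cost of tau.
   Hence ||R - S||_F^2 <= 4 n_A n_B Tr[C tau]. *)
Require Import Defs.
From HB Require Import structures.
From mathcomp Require Import all_boot all_order all_algebra.
From mathcomp Require Import sesquilinear spectral.
From mathcomp Require Import complex mxtens.
From mathcomp Require Import boolp classical_sets reals.
From mathcomp Require Import ring lra.

Set Implicit Arguments.
Unset Strict Implicit.
Unset Printing Implicit Defensive.

Import Order.TTheory GRing.Theory Num.Theory Normc.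

Local Open Scope ring_scope.
Local Open Scope sesquilinear_scope.
Local Open Scope complex_scope.

(** * Complex moduli and elementary real inequalities *)

Lemma normc_ge0 (R : rcfType) (z : R[i]) : 0 <= normc z.
Proof. by case: z => a b /=; exact: sqrtr_ge0. Qed.

Lemma normCE (R : rcfType) (z : R[i]) : `|z| = (normc z)%:C.
Proof. by rewrite normc_def; case: z. Qed.

Lemma sqr_normcE (R : rcfType) (z : R[i]) : (normc z ^+ 2)%:C = z * z^*.
Proof. by rewrite rmorphXn /= -normCE normCK. Qed.

Lemma normc_conj (R : rcfType) (z : R[i]) : normc z^* = normc z.
Proof. by apply: complexI; rewrite -!normCE norm_conjC. Qed.

Lemma Re_le_normc (R : rcfType) (z : R[i]) : complex.Re z <= normc z.
Proof.
rewrite -lecR -normCE; apply: le_trans (normc_ge_Re z).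
by rewrite lecR ler_norm.
Qed.

Lemma normc_le_sum (R : rcfType) (I : Type) (s : seq I) (P : pred I)
    (F : I -> R[i]) :
  normc (\sum_(i <- s | P i) F i) <= \sum_(i <- s | P i) normc (F i).
Proof.
rewrite -lecR rmorph_sum /= -normCE.
by under [X in _ <= X]eq_bigr do rewrite -normCE; exact: ler_norm_sum.
Qed.

Lemma ReB (R : rcfType) (y z : R[i]) :
  complex.Re (y - z) = complex.Re y - complex.Re z.
Proof. by case: y z => [? ?] []. Qed.

Lemma ReD (R : rcfType) (y z : R[i]) :
  complex.Re (y + z) = complex.Re y + complex.Re z.
Proof. by case: y z => [? ?] []. Qed.

Lemma Re_sum (R : rcfType) (I : Type) (s : seq I) (P : pred I)
    (F : I -> R[i]) :
  complex.Re (\sum_(i <- s | P i) F i) = \sum_(i <- s | P i) complex.Re (F i).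
Proof. exact: (big_morph (@complex.Re R) (@ReD R) erefl). Qed.

(** The quadratic $A t^2 - 2ct + B$ is the sum of the squares $(a_i t - b_i)^2$. At its minimiser $t
    = c/A$, its value times $A$ is $AB - c^2$. *)
Lemma sum_sqr_CS (R : realFieldType) (I : finType) (a b : I -> R) :
  (\sum_i a i * b i) ^+ 2 <= (\sum_i a i ^+ 2) * (\sum_i b i ^+ 2).
Proof.
set A := \sum_i a i ^+ 2; set B := \sum_i b i ^+ 2; set c := \sum_i a i * b i.
have A0 : 0 <= A by apply: sumr_ge0 => i _; exact: sqr_ge0.
have key t : 0 <= A * t ^+ 2 - 2 * c * t + B.
  have -> : A * t ^+ 2 - 2 * c * t + B = \sum_i (a i * t - b i) ^+ 2.
    rewrite /A /B /c mulr_suml mulr_sumr mulr_suml -sumrN -!big_split /=.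
    by apply: eq_bigr => i _; ring.
  by apply: sumr_ge0 => i _; exact: sqr_ge0.
have [A_eq0|A_neq0] := eqVneq A 0.
  have a0 i : a i = 0.
    have/psumr_eq0P H : \sum_i a i ^+ 2 = 0 by [].
    by apply/eqP; rewrite -sqrf_eq0 H // => j _; exact: sqr_ge0.
  by rewrite /c big1 => [|i _]; rewrite ?a0 ?mul0r ?expr0n ?A_eq0 ?mul0r.
have Apos : 0 < A by rewrite lt_def A_neq0.
have := mulr_ge0 A0 (key (c / A)); rewrite -[c ^+ 2 <= _]subr_ge0.
suff -> : A * (A * (c / A) ^+ 2 - 2 * c * (c / A) + B) = A * B - c ^+ 2 by [].
by field.
Qed.

(** This is $(u+v)^2 \le 2u^2 + 2v^2$, whose two sides differ by $(u-v)^2$. *)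
Lemma sqr_le_sqrtD (R : rcfType) (x a b : R) :
  0 <= x -> 0 <= a -> 0 <= b -> x <= Num.sqrt a + Num.sqrt b ->
  x ^+ 2 <= 2 * a + 2 * b.
Proof.
move=> x0 a0 b0 xle.
have le1 : x ^+ 2 <= (Num.sqrt a + Num.sqrt b) ^+ 2.
  by rewrite ler_sqr ?nnegrE ?addr_ge0 ?sqrtr_ge0.
apply: le_trans le1 _.
rewrite -[in leRHS](sqr_sqrtr a0) -[in leRHS](sqr_sqrtr b0).
rewrite -subr_ge0; apply: le_trans (sqr_ge0 (Num.sqrt a - Num.sqrt b)) _.
by rewrite le_eqVlt; apply/orP; left; apply/eqP; ring.
Qed.

(** The constant 4 is the square of the 2 in the denominator of the final bound. *)
Lemma cross_sum_le (R : realFieldType) (a b p q : R) :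
  0 <= a -> 0 <= b -> 1 <= p -> 1 <= q ->
  2 * (q * a) + 2 * (p * b) <= 4 * p * q * (a + b).
Proof.
move=> a0 b0 p1 q1.
have qa : q * a <= p * q * a.
  by rewrite -mulrA ler_peMl // mulr_ge0 // (le_trans ler01).
have pb : p * b <= p * q * b.
  by rewrite [p * q]mulrC -mulrA ler_peMl // mulr_ge0 // (le_trans ler01).
have : 0 <= p * q * a by rewrite !mulr_ge0 // (le_trans ler01).
have : 0 <= p * q * b by rewrite !mulr_ge0 // (le_trans ler01).
lra.
Qed.

(** Each [a k] is counted $q$ times and each [b l] is counted $p$ times. *)
Lemma double_sum_le (R : realFieldType) p q (a : 'I_p -> R) (b : 'I_q -> R) :
  (0 < p)%N -> (0 < q)%N -> (forall k, 0 <= a k) -> (forall l, 0 <= b l) ->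
  \sum_k \sum_l (2 * a k + 2 * b l) <=
  4 * p%:R * q%:R * (\sum_k a k + \sum_l b l).
Proof.
move=> p0 q0 a0 b0.
have -> : \sum_k \sum_l (2 * a k + 2 * b l) =
    2 * (q%:R * \sum_k a k) + 2 * (p%:R * \sum_l b l).
  have inner k : \sum_l (2 * a k + 2 * b l) = q%:R * 2 * a k + 2 * \sum_l b l.
    rewrite big_split /= sumr_const card_ord -mulr_sumr.
    by rewrite -[_ *+ q]mulr_natl mulrA.
  rewrite (eq_bigr _ (fun k _ => inner k)) big_split /= -mulr_sumr.
  by rewrite sumr_const card_ord -[_ *+ p]mulr_natl; ring.
by apply: cross_sum_le; rewrite ?ler1n ?sumr_ge0.
Qed.

(** * Adjoints and the squared Frobenius norm *)

Section Frobenius.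
Variable R : realType.
Local Notation C := R[i].

Lemma adjmxM m n p (A : 'M[C]_(m, n)) (B : 'M_(n, p)) :
  (A *m B)^t* = B^t* *m A^t*.
Proof. by rewrite trmx_mul map_mxM. Qed.

Lemma adjmxB m n (A B : 'M[C]_(m, n)) : (A - B)^t* = A^t* - B^t*.
Proof. by rewrite linearB map_mxB. Qed.

Lemma adjmx1 n : (1%:M : 'M[C]_n)^t* = 1%:M.
Proof. by rewrite trmx1 map_mx1. Qed.

Lemma adjmx_tens m n p q (A : 'M[C]_(m, n)) (B : 'M[C]_(p, q)) :
  (A *t B)^t* = A^t* *t B^t*.
Proof. by rewrite trmx_tens map_mxT. Qed.

Lemma mxtr_adj n (A : 'M[C]_n) : \tr (A^t*) = (\tr A)^*.
Proof. by rewrite rmorph_sum; apply: eq_bigr => i _; rewrite !mxE. Qed.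

Lemma hermP n (A : 'M[C]_n) : A \is hermsymmx <-> A^t* = A.
Proof.
rewrite is_hermitianmxE expr0 scale1r.
by split=> [/eqP <-//|->]; rewrite eqxx.
Qed.

Definition frob2 m n (A : 'M[C]_(m, n)) : R := \sum_i \sum_j normc (A i j) ^+ 2.

Lemma frob2_ge0 m n (A : 'M[C]_(m, n)) : 0 <= frob2 A.
Proof. by do 2![apply: sumr_ge0 => ? _]; exact: sqr_ge0. Qed.

Lemma frob2E m n (A : 'M[C]_(m, n)) : (frob2 A)%:C = \tr (A *m A^t*).
Proof.
rewrite rmorph_sum; apply: eq_bigr => i _; rewrite mxE rmorph_sum.
by apply: eq_bigr => j _; rewrite !mxE -sqr_normcE.
Qed.

Lemma frob2_adj m n (A : 'M[C]_(m, n)) : frob2 (A^t*) = frob2 A.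
Proof.
rewrite /frob2 exchange_big /=; apply: eq_bigr => i _; apply: eq_bigr => j _.
by rewrite !mxE normc_conj.
Qed.

(** Cauchy-Schwarz for the Hilbert-Schmidt inner product of $A^\dagger$ and $B$, read off the
    entries. *)
Lemma mxtr_mul_CS m n (A : 'M[C]_(m, n)) (B : 'M_(n, m)) :
  normc (\tr (A *m B)) ^+ 2 <= frob2 A * frob2 B.
Proof.
rewrite -[frob2 B]frob2_adj /frob2 !pair_big /=.
apply: le_trans (sum_sqr_CS _ _).
rewrite ler_sqr ?nnegrE ?normc_ge0 //; last first.
  by apply: sumr_ge0 => i _; rewrite mulr_ge0 ?normc_ge0.
rewrite /mxtrace; under eq_bigr do rewrite mxE.
rewrite pair_big /=; apply: le_trans (normc_le_sum _ _ _) _.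
by apply: ler_sum => i _; rewrite normcM !mxE normc_conj.
Qed.

(** Each entry of the product is a row times a column, to which Cauchy-Schwarz applies. *)
Lemma frob2_mul m n p (A : 'M[C]_(m, n)) (B : 'M_(n, p)) :
  frob2 (A *m B) <= frob2 A * frob2 B.
Proof.
rewrite -[frob2 B]frob2_adj /frob2 mulr_suml; apply: ler_sum => i _.
rewrite mulr_sumr; apply: ler_sum => k _.
have -> : (A *m B) i k = \tr (row i A *m col k B).
  by rewrite /mxtrace big_ord1 !mxE; apply: eq_bigr => j _; rewrite !mxE.
apply: le_trans (mxtr_mul_CS _ _) _; rewrite /frob2 big_ord1.
rewrite le_eqVlt; apply/orP; left; apply/eqP; congr (_ * _).
  by apply: eq_bigr => j _; rewrite mxE.
by apply: eq_bigr => j _; rewrite big_ord1 !mxE normc_conj.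
Qed.

Lemma frob2_mul_unitary m n (A : 'M[C]_(m, n)) (P : 'M_n) :
  P \is unitarymx -> frob2 (A *m P) = frob2 A.
Proof.
move=> Pu; apply: complexI; rewrite !frob2E adjmxM mulmxA.
by rewrite mulmxtVK.
Qed.

End Frobenius.

(** * Positive semidefinite matrices, tensor products, partial traces and states *)

Section Positivity.
Variable R : realType.
Local Notation C := R[i].

Lemma dotmx_frob2 m (x : 'cV[C]_m) : (x^t* *m x) 0 0 = (frob2 x)%:C.
Proof. by rewrite -frob2_adj frob2E trmxCK trace_mx11. Qed.

Lemma adj_psd n (A : 'M[C]_n) : psdmx A -> A^t* = A.
Proof. by case=> /hermP. Qed.

Lemma psd_gram m n (M : 'M[C]_(m, n)) : psdmx (M^t* *m M).
Proof.
split=> [|x]; first by apply/hermP; rewrite adjmxM trmxCK.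
by rewrite mulmxA -adjmxM -mulmxA dotmx_frob2 lecR frob2_ge0.
Qed.

Lemma psd_spectral_diag_ge0 n (A : 'M[C]_n) i :
  psdmx A -> 0 <= spectral_diag A 0 i.
Proof.
move=> [/hermitian_normalmx/orthomx_spectralP Adec].
(* The quadratic form is tested on the $i$-th eigenvector, where its value is the $i$-th
   eigenvalue. *)
move=> /(_ ((spectralmx A)^t* *m delta_mx i 0)).
have PP := unitarymxP (spectral_unitarymx A).
rewrite {2}Adec invmx_unitary ?spectral_unitarymx // adjmxM trmxCK !mulmxA.
rewrite -[_ *m spectralmx A *m _]mulmxA PP mulmx1.
rewrite -[_ *m spectralmx A *m _]mulmxA PP mulmx1.
by rewrite trmx_delta map_delta_mx -rowE -colE !mxE eqxx mulr1n.
Qed.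

(** The factor is $M = \sqrt{D}\,P$ from the spectral decomposition. It turns traces against a
    positive matrix into Frobenius norms. *)
Lemma psd_gramP n (A : 'M[C]_n) : psdmx A -> exists M : 'M_n, A = M^t* *m M.
Proof.
move=> Apsd; have [/hermitian_normalmx/orthomx_spectralP Adec _] := Apsd.
set P := spectralmx A in Adec; set D := spectral_diag A in Adec.
exists (diag_mx (map_mx sqrtC D) *m P).
rewrite adjmxM {1}Adec /P invmx_unitary ?spectral_unitarymx // -/P -!mulmxA.
congr (_ *m _); rewrite mulmxA; congr (_ *m _).
apply/matrixP => i j; rewrite tr_diag_mx map_diag_mx mul_diag_mx !mxE.
case: eqVneq => [->|]; last by rewrite !mulr0n mulr0.
rewrite !mulr1n /= (geC0_conj _) ?sqrtC_ge0 ?psd_spectral_diag_ge0 //.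
by rewrite -expr2 sqrtCK.
Qed.

(** For $A = M^\dagger M$ and $B = N^\dagger N$, cyclicity makes the trace equal to $\|N
    M^\dagger\|_F^2$. *)
Lemma psd_mxtr_mul_ge0 n (A B : 'M[C]_n) :
  psdmx A -> psdmx B -> 0 <= \tr (A *m B).
Proof.
move=> /psd_gramP [M ->] /psd_gramP [N ->].
rewrite mxtrace_mulC mulmxA mxtrace_mulC !mulmxA -mulmxA -{1}[M]trmxCK -adjmxM.
by rewrite mxtrace_mulC -frob2E lecR frob2_ge0.
Qed.

(** A tensor product of Gram matrices is the Gram matrix of $M \otimes N$. *)
Lemma psd_tens m n (A : 'M[C]_m) (B : 'M[C]_n) :
  psdmx A -> psdmx B -> psdmx (A *t B).
Proof.
move=> /psd_gramP [M ->] /psd_gramP [N ->].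
by rewrite -tensmx_mul -adjmx_tens; exact: psd_gram.
Qed.

Lemma psdZ n (c : R) (A : 'M[C]_n) : 0 <= c -> psdmx A -> psdmx (c%:C *: A).
Proof.
move=> c0 Apsd; split=> [|x].
  apply/hermP/matrixP => i j; rewrite -{2}(adj_psd Apsd) !mxE rmorphM /=.
  by congr (_ * _); rewrite geC0_conj ?lecR.
by rewrite -scalemxAr -scalemxAl mxE mulr_ge0 ?lecR //; exact: Apsd.2.
Qed.

Lemma psd_sum n (I : finType) (A : I -> 'M[C]_n) :
  (forall i, psdmx (A i)) -> psdmx (\sum_i A i).
Proof.
move=> Apsd; split=> [|x].
  apply/hermP; rewrite linear_sum /= raddf_sum; apply: eq_bigr => i _.
  exact: adj_psd.
rewrite mulmx_sumr mulmx_suml summxE; apply: sumr_ge0 => i _.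
exact: (Apsd i).2.
Qed.

Lemma psd1 n : psdmx (1%:M : 'M[C]_n).
Proof. by rewrite -[1%:M]mulmx1 -{1}adjmx1; exact: psd_gram. Qed.

Lemma mxtr_tens m n (A : 'M[C]_m) (B : 'M[C]_n) :
  \tr (A *t B) = \tr A * \tr B.
Proof.
rewrite /mxtrace mulr_sum; apply: eq_bigr => i _.
by rewrite !mxE.
Qed.

Lemma tensmx1 m n : (1%:M : 'M[C]_m) *t (1%:M : 'M[C]_n) = 1%:M.
Proof.
apply/matrixP => i j.
case: (mxtens_indexP i) => a b; case: (mxtens_indexP j) => c d.
rewrite tensmxE !mxE (can_eq (@mxtens_indexK m n)) xpair_eqE.
by case: (a == c); case: (b == d); rewrite /= ?mulr0 ?mul0r ?mulr1.
Qed.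

Lemma tensmxBl m n p q (A A' : 'M[C]_(m, n)) (B : 'M[C]_(p, q)) :
  (A - A') *t B = A *t B - A' *t B.
Proof. by apply/matrixP => i j; rewrite !mxE mulrBl. Qed.

Lemma tensmxBr m n p q (A : 'M[C]_(m, n)) (B B' : 'M[C]_(p, q)) :
  A *t (B - B') = A *t B - A *t B'.
Proof. by apply/matrixP => i j; rewrite !mxE mulrBr. Qed.

Lemma sum_mxtens (V : nmodType) m n (F : 'I_(m * n) -> V) :
  \sum_i F i = \sum_j \sum_k F (mxtens_index (j, k)).
Proof.
rewrite pair_big /= (reindex (@mxtens_index m n)) /=.
  by apply: eq_bigr => -[].
exists (@mxtens_unindex m n) => i _.
  exact: mxtens_indexK.
exact: mxtens_unindexK.
Qed.

Lemma mxtr_mul_tensl m n (T : 'M[C]_(m * n)) (A : 'M[C]_m) :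
  \tr (T *m (A *t 1%:M)) = \tr (ptrace2 T *m A).
Proof.
rewrite /mxtrace sum_mxtens; apply: eq_bigr => i _.
rewrite mxE; under [RHS]eq_bigr do rewrite mxE mulr_suml.
rewrite [RHS]exchange_big; apply: eq_bigr => k _ /=.
rewrite mxE sum_mxtens; apply: eq_bigr => j _.
rewrite (bigD1 k) //= big1 ?addr0 => [|l lk].
  by rewrite tensmxE mxE eqxx mulr1.
by rewrite tensmxE mxE (negPf lk) !mulr0.
Qed.

Lemma mxtr_mul_tensr m n (T : 'M[C]_(m * n)) (A : 'M[C]_n) :
  \tr (T *m (1%:M *t A)) = \tr (ptrace1 T *m A).
Proof.
rewrite /mxtrace sum_mxtens exchange_big; apply: eq_bigr => i _ /=.
rewrite mxE; under [RHS]eq_bigr do rewrite mxE mulr_suml.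
rewrite [RHS]exchange_big; apply: eq_bigr => k _ /=.
rewrite mxE sum_mxtens (bigD1 k) //= [X in _ + X]big1 ?addr0 => [|l lk].
  by apply: eq_bigr => j _; rewrite tensmxE mxE eqxx mul1r.
by apply: big1 => j _; rewrite tensmxE mxE (negPf lk) mul0r mulr0.
Qed.

Lemma ptrace2_tens m n (A : 'M[C]_m) (B : 'M[C]_n) :
  ptrace2 (A *t B) = \tr B *: A.
Proof.
apply/matrixP => i j; rewrite !mxE mulr_suml.
by apply: eq_bigr => k _; rewrite tensmxE mulrC.
Qed.

Lemma ptrace1_tens m n (A : 'M[C]_m) (B : 'M[C]_n) :
  ptrace1 (A *t B) = \tr A *: B.
Proof.
apply/matrixP => i j; rewrite !mxE mulr_suml.
by apply: eq_bigr => k _; rewrite tensmxE.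
Qed.

Lemma density_tens m n (A : 'M[C]_m) (B : 'M[C]_n) :
  density A -> density B -> density (A *t B).
Proof.
move=> [Apsd trA] [Bpsd trB]; split; first exact: psd_tens.
by rewrite mxtr_tens trA trB mulr1.
Qed.

(** The product coupling shows that the infimum in [W1] runs over a nonempty set. *)
Lemma coupling_tens n (A B : 'M[C]_n) :
  density A -> density B -> coupling A B (A *t B).
Proof.
move=> Ad Bd; split; first exact: density_tens.
  by rewrite ptrace2_tens Bd.2 scale1r.
by rewrite ptrace1_tens Ad.2 scale1r.
Qed.

Lemma density_separable dA dB (sigma : 'M[C]_(dA * dB)) :
  separable sigma -> density sigma.
Proof.
case=> n [p [sA [sB [p0 p1 sAd sBd ->]]]]; split.
  apply: psd_sum => k; apply: psdZ => //.
  by apply: psd_tens; [case: (sAd k)|case: (sBd k)].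
rewrite raddf_sum /= -[RHS]/(1%:C) -p1 rmorph_sum; apply: eq_bigr => k _.
by rewrite linearZ /= mxtr_tens (sAd k).2 (sBd k).2 !mulr1.
Qed.

(** In dimension 0 the trace is an empty sum, so it cannot be 1. *)
Lemma density_gt0 n (A : 'M[C]_n) : density A -> (0 < n)%N.
Proof.
case: n A => // A [_]; rewrite /mxtrace big_ord0 => /eqP.
by rewrite eq_sym oner_eq0.
Qed.

Lemma density_mixed n : (0 < n)%N -> density ((n%:R^-1)%:C *: 1%:M : 'M[C]_n).
Proof.
move=> n0; split; first by apply: psdZ; [rewrite invr_ge0 ler0n|exact: psd1].
rewrite linearZ /= mxtrace1 -(rmorph_nat (real_complex R)) -rmorphM /=.
by rewrite mulVf ?pnatr_eq0 -?lt0n.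
Qed.

(** The product of the maximally mixed states makes the infimum over separable states one over a
    nonempty set. *)
Lemma separable_mixed dA dB : (0 < dA)%N -> (0 < dB)%N ->
  @separable R dA dB
    (((dA%:R^-1)%:C *: 1%:M) *t ((dB%:R^-1)%:C *: 1%:M)).
Proof.
move=> dA0 dB0; exists 1%N, (fun=> 1), (fun=> (dA%:R^-1)%:C *: 1%:M),
  (fun=> (dB%:R^-1)%:C *: 1%:M).
split; rewrite ?big_ord1 ?scale1r // => k; exact: density_mixed.
Qed.

End Positivity.

(** * Cauchy-Schwarz in a state and differences between the two copies *)

Section Observables.
Variable R : realType.
Local Notation C := R[i].

Lemma Re_mxtr_sqr m n (M : 'M[C]_(m, n)) (A : 'M_n) :
  A^t* = A -> complex.Re (\tr (M^t* *m M *m (A *m A))) = frob2 (M *m A).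
Proof.
move=> Aherm; rewrite -mulmxA mxtrace_mulC -!mulmxA.
by rewrite -{2}Aherm -adjmxM mulmxA -frob2E.
Qed.

Lemma psd_mxtr_sqr_ge0 n (T A : 'M[C]_n) :
  psdmx T -> A^t* = A -> 0 <= complex.Re (\tr (T *m (A *m A))).
Proof. by move=> /psd_gramP [M ->] /Re_mxtr_sqr ->; exact: frob2_ge0. Qed.

(** With $T = M^\dagger M$, the left-hand trace pairs $MA$ with $B M^\dagger$, so the Frobenius
    Cauchy-Schwarz inequality applies. *)
Lemma psd_mxtr_CS n (T A B : 'M[C]_n) :
  psdmx T -> A^t* = A -> B^t* = B ->
  normc (\tr (T *m (A *m B))) ^+ 2 <=
  complex.Re (\tr (T *m (A *m A))) * complex.Re (\tr (T *m (B *m B))).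
Proof.
move=> /psd_gramP [M ->] Ah Bh; rewrite !Re_mxtr_sqr //.
rewrite -[M^t* *m M *m _]mulmxA mxtrace_mulC.
rewrite [M *m (A *m B)]mulmxA -[_ *m B *m _]mulmxA.
rewrite -[frob2 (M *m B)]frob2_adj adjmxM Bh.
exact: mxtr_mul_CS.
Qed.

(** For Hermitian $A$ this is operator norm at most 1, put as $A^2 \le 1$ so that it can be traced
    against a state. *)
Definition contractive n (A : 'M[C]_n) : Prop :=
  A^t* = A /\ psdmx (1%:M - A *m A).

Lemma contractive_tensl m n (A : 'M[C]_m) :
  contractive A -> contractive (A *t (1%:M : 'M_n)).
Proof.
move=> [Ah Ac]; split; first by rewrite adjmx_tens Ah adjmx1.
by rewrite tensmx_mul mulmx1 -tensmx1 -tensmxBl; apply: psd_tens Ac (psd1 _ _).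
Qed.

Lemma contractive_tensr m n (A : 'M[C]_n) :
  contractive A -> contractive ((1%:M : 'M_m) *t A).
Proof.
move=> [Ah Ac]; split; first by rewrite adjmx_tens Ah adjmx1.
by rewrite tensmx_mul mulmx1 -tensmx1 -tensmxBr; apply: psd_tens (psd1 _ _) Ac.
Qed.

(** The operator norm is at most the Frobenius norm, which is 1 here: $\|Ax\|^2 \le \|A\|_F^2
    \|x\|^2$. *)
Lemma contractive_normalized n (A : 'M[C]_n) :
  A^t* = A -> \tr (A *m A) = 1 -> contractive A.
Proof.
move=> Ah trA; split=> //; split=> [|x].
  by apply/hermP; rewrite adjmxB adjmx1 adjmxM Ah.
rewrite mulmxBr mulmxBl mulmx1 -{1}Ah mulmxA -adjmxM -[_ *m A *m x]mulmxA.
rewrite !mxE; set y := A *m x.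
have -> : (\sum_j x^t* 0 j * x j 0 = (x^t* *m x) 0 0) by rewrite mxE.
have -> : (\sum_j y^t* 0 j * y j 0 = (y^t* *m y) 0 0) by rewrite mxE.
rewrite !dotmx_frob2 -rmorphB lecR subr_ge0 /y.
apply: le_trans (frob2_mul _ _) _.
suff -> : frob2 A = 1 by rewrite mul1r.
by apply: complexI; rewrite frob2E Ah trA.
Qed.

(** In Cauchy-Schwarz the second factor satisfies $\mathrm{Tr}(T B^2) \le \mathrm{Tr}\,T = 1$. *)
Lemma density_contractive_le n (T A B : 'M[C]_n) :
  density T -> A^t* = A -> contractive B ->
  normc (\tr (T *m (A *m B))) <= Num.sqrt (complex.Re (\tr (T *m (A *m A)))).
Proof.
move=> [Tpsd trT] Ah [Bh Bc].
have a0 := psd_mxtr_sqr_ge0 Tpsd Ah.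
rewrite -[normc _]ger0_norm ?normc_ge0 // -sqrtr_sqr ler_sqrt //.
apply: le_trans (psd_mxtr_CS Tpsd Ah Bh) _.
rewrite ler_piMr // -subr_ge0.
have := psd_mxtr_mul_ge0 Tpsd Bc.
by rewrite mulmxBr mulmx1 linearB /= trT lecE ReB => /andP [].
Qed.

(** [sqdiff X] is by definition the square of this operator. *)
Definition copydiff n (X : 'M[C]_n) : 'M[C]_(n * n) := X *t 1%:M - 1%:M *t X.

Lemma adj_copydiff n (X : 'M[C]_n) : X^t* = X -> (copydiff X)^t* = copydiff X.
Proof. by move=> Xh; rewrite adjmxB !adjmx_tens Xh adjmx1. Qed.

(** A Leibniz rule: the cross terms $Y \otimes X$ cancel, leaving $XY \otimes 1 - 1 \otimes YX$, and
    commutation identifies $YX$ with $XY$. *)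
Lemma copydiff_mul n (X Y : 'M[C]_n) : X *m Y = Y *m X ->
  copydiff (X *m Y) = copydiff X *m (Y *t 1%:M) + copydiff Y *m (1%:M *t X).
Proof.
move=> XY; rewrite !mulmxBl !tensmx_mul !mulmx1 !mul1mx XY.
by rewrite addrA subrK.
Qed.

Lemma mxtr_coupling_copydiff n (rho sigma X : 'M[C]_n) S :
  coupling rho sigma S ->
  \tr (rho *m X) - \tr (sigma *m X) = \tr (S *m copydiff X).
Proof.
case=> _ <- <-; rewrite mulmxBr linearB /=.
by rewrite mxtr_mul_tensl mxtr_mul_tensr.
Qed.

End Observables.

(** * Length of the Bloch vector of a state *)

Section Bloch.
Variable R : realType.
Local Notation C := R[i].

Lemma mxtr_sum n (I : finType) (A : I -> 'M[C]_n) :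
  \tr (\sum_i A i) = \sum_i \tr (A i).
Proof. exact: raddf_sum. Qed.

Lemma mxtr_herm_real n (A B : 'M[C]_n) :
  A^t* = A -> B^t* = B -> (\tr (A *m B))^* = \tr (A *m B).
Proof. by move=> Ah Bh; rewrite -mxtr_adj adjmxM Ah Bh mxtrace_mulC. Qed.

(** For $s = M^\dagger M$, submultiplicativity gives $\|s\|_F \le \|M\|_F^2 = \mathrm{Tr}\,s =
    1$. *)
Lemma frob2_density n (s : 'M[C]_n) : density s -> frob2 s <= 1.
Proof.
move=> [/psd_gramP [M ->] trM]; apply: le_trans (frob2_mul _ _) _.
suff M1 : frob2 M = 1 by rewrite frob2_adj M1 mulr1.
by rewrite -frob2_adj; apply: complexI; rewrite frob2E trmxCK trM.
Qed.

(** Bessel's inequality for the orthonormal family formed by $1/\sqrt{d}$ times the identity and the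
    [F k]. The residual [D] has squared norm $\|s\|_F^2 - 1/d - \sum_k a_k^2$, and $\|s\|_F \le
    1$. *)
Lemma bloch_norm_le d (F : 'I_(d ^ 2 - 1) -> 'M[C]_d) (s : 'M[C]_d) :
  observable_family F -> density s ->
  \sum_k normc (\tr (s *m F k)) ^+ 2 <= 1 - 1 / d%:R.
Proof.
move=> [Fherm Ftr Forth _] sd; have d0 := density_gt0 sd.
have [/adj_psd sh trs] := sd.
have Fh k : (F k)^t* = F k by apply/hermP.
pose a k := \tr (s *m F k).
have ah k : (a k)^* = a k by exact: mxtr_herm_real.
pose c : C := d%:R^-1.
have ch : c^* = c by rewrite /c rmorphV ?unitfE ?pnatr_eq0 -?lt0n // rmorph_nat.
have cd : c * d%:R = 1 by rewrite mulVf ?pnatr_eq0 -?lt0n.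
have [D defD] : exists D, D = s - c%:M - \sum_k a k *: F k by eexists.
have Dh : D^t* = D.
  rewrite defD !adjmxB sh; congr (_ - _ - _).
    by rewrite tr_scalar_mx map_scalar_mx; congr _%:M.
  rewrite linear_sum /= raddf_sum; apply: eq_bigr => k _.
  by rewrite linearZ /= map_mxZ Fh; congr (_ *: _); exact: ah.
have DF k : \tr (D *m F k) = 0.
  rewrite defD !mulmxBl !linearB /= mul_scalar_mx linearZ /= Ftr mulr0 subr0.
  rewrite mulmx_suml mxtr_sum (bigD1 k) //= big1 => [|l lk].
    by rewrite -scalemxAl linearZ /= Forth eqxx mulr1 addr0 subrr.
  by rewrite -scalemxAl linearZ /= Forth (negPf lk) mulr0.
have trD : \tr D = 0.
  rewrite defD !linearB /= trs mxtrace_scalar -[c *+ d]mulr_natr cd subrr sub0r.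
  by rewrite mxtr_sum big1 ?oppr0 // => k _; rewrite /= linearZ /= Ftr mulr0.
(* Since [D] is orthogonal to the identity and to every [F k], $\mathrm{Tr}(D^2) = \mathrm{Tr}(Ds)$;
   only then is the other factor expanded. *)
have DD : (frob2 D)%:C = (frob2 s)%:C - c - \sum_k a k * a k.
  rewrite frob2E Dh {2}defD !mulmxBr mul_mx_scalar !linearB /= linearZ /= trD.
  rewrite mulr0 subr0 mulmx_sumr mxtr_sum big1 => [|k _]; last first.
    by rewrite -scalemxAr linearZ /= DF mulr0.
  rewrite subr0 defD !mulmxBl !linearB /= mul_scalar_mx linearZ /= trs mulr1.
  rewrite frob2E sh; congr (_ - _ - _).
  rewrite mulmx_suml mxtr_sum; apply: eq_bigr => k _ /=.
  by rewrite -scalemxAl linearZ /= mxtrace_mulC.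
have eD : frob2 D = frob2 s - 1 / d%:R - \sum_k normc (a k) ^+ 2.
  have aE : \sum_k a k * a k = (\sum_k normc (a k) ^+ 2)%:C.
    by rewrite rmorph_sum; apply: eq_bigr => k _; rewrite -{2}ah -sqr_normcE.
  by apply: complexI; rewrite DD aE !rmorphB /= mul1r fmorphV rmorph_nat.
have := frob2_ge0 D; rewrite eD subr_ge0 => /le_trans; apply.
by rewrite lerD2r frob2_density.
Qed.

End Bloch.

(** * The partial isometry of the polar decomposition *)

Section Polar.
Variable R : realType.
Local Notation C := R[i].

(** Selecting the rows of $P$ where [e] holds makes an identity matrix of size [#|e|] factor through
    [U]. *)
Lemma natr_count_le_rank m n (U : 'M[C]_(m, n)) (P : 'M_n) (e : 'I_n -> bool) :
  P \is unitarymx -> U^t* *m U = P^t* *m diag_mx (\row_i (e i)%:R) *m P ->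
  (\sum_i (e i) <= \rank U)%N.
Proof.
move=> Pu UU.
have -> : (\sum_i (e i) = #|e|)%N by rewrite -sum1_card [RHS]big_mkcond.
pose f (a : 'I_#|e|) : 'I_n := enum_val a.
have PP : P *m P^t* = 1%:M by apply/unitarymxP.
apply: (@mulmx1_min_rank _ _ _ _ _ (rowsub f P *m U^t*) ((rowsub f P)^t*)).
rewrite -[_ *m U^t* *m U]mulmxA UU rowsubE adjmxM !mulmxA.
rewrite -[_ *m P *m P^t*]mulmxA PP mulmx1 -[_ *m P *m P^t*]mulmxA PP mulmx1.
have -> : (rowsub f (1%:M : 'M[C]_n))^t* = colsub f 1%:M.
  by rewrite -[in RHS]adjmx1; apply/matrixP => i j; rewrite !mxE.
rewrite -rowsubE mulmx_colsub mulmx1; apply/matrixP => a b; rewrite !mxE.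
by rewrite (inj_eq enum_val_inj); have := enum_valP a; rewrite unfold_in => ->.
Qed.

(** Take $U = A|A|^+$, with $|A|^+$ the pseudo-inverse of $|A| = \sqrt{A^\dagger A}$. Then
    $U^\dagger A = |A|$, and $U^\dagger U$ is the orthogonal projection onto the support of
    $|A|$. *)
Lemma polar m n (A : 'M[C]_(m, n)) :
  exists U : 'M_(m, n), [/\ trnorm A = complex.Re (\tr (U^t* *m A)),
    frob2 U <= (\rank A)%:R & forall x : 'cV_n, frob2 (U *m x) <= frob2 x].
Proof.
set G := A^t* *m A; have Gpsd : psdmx G by exact: psd_gram.
have [/hermitian_normalmx/orthomx_spectralP Gdec _] := Gpsd.
have D0 i : 0 <= spectral_diag G 0 i by exact: psd_spectral_diag_ge0.
have tn : trnorm A =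
    complex.Re (\tr (diag_mx (map_mx sqrtC (spectral_diag G)))).
  rewrite /trnorm -/G /sqrtmx mxtrace_mulC mulmxA mulmxV ?spectral_unit //.
  by rewrite mul1mx.
move: Gdec D0 tn; rewrite invmx_unitary ?spectral_unitarymx //.
move: (spectralmx G) (spectral_unitarymx G) (spectral_diag G) => P Pu D.
move=> Gdec D0 ->.
have PP : P *m P^t* = 1%:M by apply/unitarymxP.
pose s i := sqrtC (D 0 i).
have s0 i : 0 <= s i by rewrite sqrtC_ge0.
have ss i : s i * s i = D 0 i by rewrite -expr2 sqrtCK.
(* As 0^-1 = 0, this is the pseudo-inverse of the singular values of A. *)
pose V := diag_mx (\row_i (s i)^-1).
have Vh : V^t* = V.
  rewrite /V tr_diag_mx map_diag_mx; congr diag_mx; apply/rowP => i.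
  by rewrite !mxE; apply: geC0_conj; rewrite invr_ge0.
pose U := A *m P^t* *m V *m P.
have UA : U^t* *m A = P^t* *m diag_mx (map_mx sqrtC D) *m P.
  rewrite /U !adjmxM Vh trmxCK -!mulmxA; congr (_ *m _).
  rewrite -/G Gdec !mulmxA -[V *m P *m _]mulmxA PP mulmx1; congr (_ *m _).
  rewrite mulmx_diag; congr diag_mx; apply/rowP => i; rewrite !mxE -/(s i) -ss.
  by have [->|s_neq0] := eqVneq (s i) 0; rewrite ?mulr0 // mulKf.
have UU : U^t* *m U = P^t* *m diag_mx (\row_i (s i != 0)%:R) *m P.
  rewrite {2}/U !mulmxA UA -[X in X *m V *m P]mulmxA PP mulmx1; congr (_ *m _).
  rewrite -mulmxA mulmx_diag; congr (_ *m diag_mx _); apply/rowP => i.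
  rewrite !mxE -/(s i).
  by have [->|s_neq0] := eqVneq (s i) 0; rewrite ?mul0r // mulfV.
exists U; split.
- by rewrite UA mxtrace_mulC mulmxA PP mul1mx.
(* $\|U\|_F^2 = \mathrm{Tr}(U^\dagger U)$ counts the nonzero singular values; $\mathrm{rank}\,U \le
   \mathrm{rank}\,A$ because $A$ is a left factor of $U$. *)
- apply: (@le_trans _ _ (\rank U)%:R); last first.
    by rewrite ler_nat /U -!mulmxA mxrankM_maxl.
  have -> : frob2 U = (\sum_i (s i != 0%R))%N%:R.
    rewrite -frob2_adj; apply: complexI; rewrite frob2E trmxCK UU mxtrace_mulC.
    rewrite mulmxA PP mul1mx rmorph_nat natr_sum mxtrace_diag.
    by apply: eq_bigr => i _; rewrite mxE.
  by rewrite ler_nat; exact: natr_count_le_rank Pu UU.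
(* In the coordinates $y = Px$, $\|Ux\|^2$ keeps only the $|y_i|^2$ with $s_i \ne 0$. *)
- move=> x; have -> : frob2 x = frob2 (P *m x). 
    rewrite -(frob2_adj x) -(frob2_adj (P *m x)) (adjmxM P x).
    by rewrite frob2_mul_unitary ?trmxC_unitary.
  rewrite -lecR -!dotmx_frob2 adjmxM -mulmxA [U^t* *m _]mulmxA UU !mulmxA.
  rewrite -adjmxM -!mulmxA; move: (P *m x) => y; rewrite mul_diag_mx !mxE.
  apply: ler_sum => i _; rewrite !mxE mulrCA -[X in _ <= X]mul1r.
  apply: ler_wpM2r; last by case: eqP.
  by rewrite mulrC mul_conjC_ge0.
Qed.

End Polar.

(** * Correlation matrices compared with the transport cost *)

Section Estimate.
Variable R : realType.
Local Notation C := R[i].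

(** The mean square of [copydiff X] in [S], that is, the share of [X] in the cost. *)
Definition deviation n (S : 'M[C]_(n * n)) (X : 'M[C]_n) : R :=
  complex.Re (\tr (sqdiff X *m S)).

Lemma deviation_ge0 n (S : 'M[C]_(n * n)) (X : 'M[C]_n) :
  psdmx S -> X^t* = X -> 0 <= deviation S X.
Proof.
move=> Spsd Xh; rewrite /deviation mxtrace_mulC.
exact: psd_mxtr_sqr_ge0 (adj_copydiff Xh).
Qed.

(** The Leibniz rule for the commuting factors $F \otimes 1$ and $1 \otimes G$ leaves two terms,
    each a [copydiff] times a contraction acting on one copy. *)
Lemma coupling_correlation_le dA dB (F : 'M[C]_dA) (G : 'M[C]_dB)
    (rho sigma : 'M[C]_(dA * dB)) S :
  coupling rho sigma S -> contractive F -> contractive G ->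
  normc (\tr (rho *m (F *t G)) - \tr (sigma *m (F *t G))) <=
  Num.sqrt (deviation S (F *t 1%:M)) + Num.sqrt (deviation S (1%:M *t G)).
Proof.
move=> cS Fc Gc; have [Sd _ _] := cS; rewrite (mxtr_coupling_copydiff _ cS).
have FGc : F *t G = (F *t 1%:M) *m (1%:M *t G) by exact: tensmx_decr.
have GFc : F *t G = (1%:M *t G) *m (F *t 1%:M) by exact: tensmx_decl.
rewrite FGc copydiff_mul -?FGc // mulmxDr linearD /=.
apply: le_trans (le_normcD _ _) _.
have dev X : deviation S X = complex.Re (\tr (S *m (copydiff X *m copydiff X))).
  by rewrite /deviation mxtrace_mulC.
rewrite !dev; apply: lerD; apply: density_contractive_le => //.
- by apply: adj_copydiff; rewrite adjmx_tens Fc.1 adjmx1.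
- exact/contractive_tensl/contractive_tensr.
- by apply: adj_copydiff; rewrite adjmx_tens Gc.1 adjmx1.
- exact/contractive_tensr/contractive_tensl.
Qed.

Variables (dA dB : nat).
Variables (FA : 'I_(dA ^ 2 - 1) -> 'M[C]_dA) (FB : 'I_(dB ^ 2 - 1) -> 'M[C]_dB).
Hypotheses (hFA : observable_family FA) (hFB : observable_family FB).

Lemma observable_contractive d (F : 'I_(d ^ 2 - 1) -> 'M[C]_d) k :
  observable_family F -> contractive (F k).
Proof.
case=> Fh _ Fo _; apply: contractive_normalized; first by apply/hermP.
by rewrite Fo eqxx.
Qed.

Lemma cost_deviation (S : 'M[C]_((dA * dB) * (dA * dB))) :
  complex.Re (\tr (cost FA FB *m S)) =
  \sum_k deviation S (FA k *t 1%:M) + \sum_l deviation S (1%:M *t FB l).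
Proof.
rewrite /cost mulmxDl linearD /= ReD !mulmx_suml !mxtr_sum !Re_sum.
by [].
Qed.

Lemma cost_ge0 (S : 'M[C]_((dA * dB) * (dA * dB))) :
  psdmx S -> 0 <= complex.Re (\tr (cost FA FB *m S)).
Proof.
move=> Spsd; rewrite cost_deviation addr_ge0 //; apply: sumr_ge0 => k _.
  apply: deviation_ge0 => //.
  by rewrite adjmx_tens adjmx1 (observable_contractive k hFA).1.
apply: deviation_ge0 => //.
by rewrite adjmx_tens adjmx1 (observable_contractive k hFB).1.
Qed.

(** The entrywise bound is squared and summed over all pairs of observables. *)
Lemma frob2_correlation_diff_le (rho sigma : 'M[C]_(dA * dB)) S :
  (0 < dA ^ 2 - 1)%N -> (0 < dB ^ 2 - 1)%N -> coupling rho sigma S ->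
  frob2 (correlation_mx FA FB rho - correlation_mx FA FB sigma) <=
  4 * (dA ^ 2 - 1)%:R * (dB ^ 2 - 1)%:R * complex.Re (\tr (cost FA FB *m S)).
Proof.
move=> nA0 nB0 cS; have [[Spsd _] _ _] := cS.
set nA := (dA ^ 2 - 1)%N in nA0 *; set nB := (dB ^ 2 - 1)%N in nB0 *.
rewrite cost_deviation.
set a := fun k => deviation S (FA k *t 1%:M);
  set b := fun l => deviation S (1%:M *t FB l).
have a0 k : 0 <= a k.
  apply: deviation_ge0 => //.
  by rewrite adjmx_tens adjmx1 (observable_contractive k hFA).1.
have b0 k : 0 <= b k.
  apply: deviation_ge0 => //.
  by rewrite adjmx_tens adjmx1 (observable_contractive k hFB).1.
have ab k l :
    normc (\tr (rho *m (FA k *t FB l)) - \tr (sigma *m (FA k *t FB l))) ^+ 2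
      <= 2 * a k + 2 * b l.
  apply: (sqr_le_sqrtD (normc_ge0 _) (a0 k) (b0 l)).
  exact: coupling_correlation_le cS (observable_contractive k hFA)
    (observable_contractive l hFB).
apply: (@le_trans _ _ (\sum_k \sum_l (2 * a k + 2 * b l))).
  by apply: ler_sum => k _; apply: ler_sum => l _; rewrite 4!mxE; exact: ab.
exact: double_sum_le.
Qed.

Lemma separable_correlation_le (U : 'M[C]_(dA ^ 2 - 1, dB ^ 2 - 1)) sigma :
  (forall x : 'cV_(dB ^ 2 - 1), frob2 (U *m x) <= frob2 x) -> separable sigma ->
  complex.Re (\tr (U^t* *m correlation_mx FA FB sigma)) <=
  Num.sqrt (1 - 1 / dA%:R) * Num.sqrt (1 - 1 / dB%:R).
Proof.
move=> Ule [n [p [sA [sB [p0 p1 sAd sBd sE]]]]].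
(* Bloch vectors as a column and a row: the correlation matrix of a product state is their outer
   product. *)
pose a k : 'cV[C]_(dA ^ 2 - 1) := \col_i \tr (sA k *m FA i).
pose b k : 'rV[C]_(dB ^ 2 - 1) := \row_j \tr (sB k *m FB j).
have -> : correlation_mx FA FB sigma = \sum_k (p k)%:C *: (a k *m b k).
  apply/matrixP => i j; rewrite mxE sE mulmx_suml mxtr_sum summxE.
  apply: eq_bigr => k _; rewrite -scalemxAl linearZ /= tensmx_mul mxtr_tens.
  by rewrite !mxE big_ord1 !mxE.
have a_le k : frob2 (a k) <= 1 - 1 / dA%:R.
  apply: le_trans (bloch_norm_le hFA (sAd k)).
  by apply: ler_sum => i _; rewrite big_ord1 mxE.
have b_le k : frob2 (b k) <= 1 - 1 / dB%:R.
  apply: le_trans (bloch_norm_le hFB (sBd k)).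
  by rewrite /frob2 big_ord1; apply: ler_sum => i _; rewrite mxE.
rewrite mulmx_sumr mxtr_sum Re_sum.
rewrite -[leRHS]mul1r -{1}p1 mulr_suml; apply: ler_sum => k _.
have -> : complex.Re (\tr (U^t* *m ((p k)%:C *: (a k *m b k)))) =
    p k * complex.Re (\tr (U^t* *m (a k *m b k))).
  rewrite -scalemxAr linearZ /=.
  by case: (\tr _) => x y /=; rewrite mul0r subr0.
apply: ler_wpM2l => //; apply: le_trans (Re_le_normc _) _.
rewrite -[leLHS]ger0_norm ?normc_ge0 // -sqrtr_sqr.
have cA0 : 0 <= 1 - 1 / dA%:R :> R.
  by apply: le_trans (a_le k); exact: frob2_ge0.
have cB0 : 0 <= 1 - 1 / dB%:R :> R.
  by apply: le_trans (b_le k); exact: frob2_ge0.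
rewrite -sqrtrM //; apply: ler_wsqrtr.
have -> : \tr (U^t* *m (a k *m b k)) = \tr (a k *m (b k *m U^t*)).
  by rewrite mxtrace_mulC -mulmxA.
apply: le_trans (mxtr_mul_CS _ _) _; apply: ler_pM; rewrite ?frob2_ge0 //.
(* $\|b\,U^\dagger\|_F = \|U b^\dagger\|_F$, and $U$ does not increase lengths. *)
rewrite -frob2_adj adjmxM trmxCK; apply: le_trans (Ule _) _.
by rewrite frob2_adj.
Qed.

Lemma trnorm_correlation_le (rho sigma : 'M[C]_(dA * dB)) S :
  (0 < dA ^ 2 - 1)%N -> (0 < dB ^ 2 - 1)%N ->
  separable sigma -> coupling rho sigma S ->
  trnorm (correlation_mx FA FB rho)
    - Num.sqrt (1 - 1 / dA%:R) * Num.sqrt (1 - 1 / dB%:R) <=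
  2 * Num.sqrt ((\rank (correlation_mx FA FB rho))%:R * (dA ^ 2 - 1)%:R
                * (dB ^ 2 - 1)%:R)
    * Num.sqrt (complex.Re (\tr (cost FA FB *m S))).
Proof.
move=> nA0 nB0 sep cS; have [[Spsd _] _ _] := cS.
have c0 := cost_ge0 Spsd; have fle := frob2_correlation_diff_le nA0 nB0 cS.
have [U [-> Ur Ule]] := polar (correlation_mx FA FB rho).
rewrite lerBlDr.
(* The separable part contributes at most $c_A c_B$; what remains is
   $\mathrm{Re}\,\mathrm{Tr}(U^\dagger(R - S))$. *)
rewrite -{1}[correlation_mx FA FB rho](subrK (correlation_mx FA FB sigma)).
rewrite mulmxDr linearD /= ReD lerD //; last exact: separable_correlation_le.
apply: le_trans (Re_le_normc _) _.
rewrite -[leLHS]ger0_norm ?normc_ge0 // -sqrtr_sqr.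
have -> : 2 = Num.sqrt 4 :> R.
  have -> : 4 = 2 ^+ 2 :> R by ring.
  by rewrite sqrtr_sqr ger0_norm ?ler0n.
rewrite -!sqrtrM ?mulr_ge0 ?ler0n //; apply: ler_wsqrtr.
(* The rank enters here, through $\|U\|_F^2 \le \mathrm{rank}\,R$. *)
apply: le_trans (mxtr_mul_CS _ _) _; rewrite frob2_adj.
apply: le_trans (ler_pM (frob2_ge0 _) (frob2_ge0 _) Ur fle) _.
by rewrite le_eqVlt; apply/orP; left; apply/eqP; ring.
Qed.

End Estimate.

(** * Passage to the two infima *)

Theorem theorem6 (R : realType) (dA dB : nat)
    (FA : 'I_(dA ^ 2 - 1) -> 'M[R[i]]_dA) (FB : 'I_(dB ^ 2 - 1) -> 'M[R[i]]_dB)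
    (hFA : observable_family FA) (hFB : observable_family FB)
    (rho : 'M[R[i]]_(dA * dB)) (hrho : density rho) :
  let Rm := correlation_mx FA FB rho in
  let r := \rank Rm in
  let nA := (dA ^ 2 - 1)%N in
  let nB := (dB ^ 2 - 1)%N in
  let cA : R := Num.sqrt (1 - 1 / dA%:R) in
  let cB : R := Num.sqrt (1 - 1 / dB%:R) in
  1 / (2 * Num.sqrt (r%:R * nA%:R * nB%:R)) * (trnorm Rm - cA * cB)
    <= wasserstein_ent FA FB rho.
Proof.
cbv zeta.
have [dA0 dB0] : (0 < dA)%N /\ (0 < dB)%N.
  by apply/andP; rewrite -muln_gt0; exact: density_gt0 hrho.
apply: lb_le_inf.
  by eexists; eexists; first exact: separable_mixed dA0 dB0.
move=> _ [sigma sep <-].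
set q := (X in Num.sqrt X); set L := (X in X <= _).
(* A nonpositive left-hand side lies below any square root; otherwise both sides may be squared. *)
have [L0|L0] := leP L 0; first exact: le_trans L0 (sqrtr_ge0 _).
(* If q = 0, then L = 0 because 1 / 0 = 0. *)
have q0 : 0 < q.
  rewrite lt_def !mulr_ge0 ?ler0n // andbT; apply: contraTneq L0 => q_eq0.
  by rewrite /L q_eq0 sqrtr0 mulr0 invr0 mulr0 mul0r ltxx.
have [nA0 nB0] : (0 < dA ^ 2 - 1)%N /\ (0 < dB ^ 2 - 1)%N.
  move: (lt0r_neq0 q0); rewrite !mulf_eq0 !negb_or !pnatr_eq0 -!lt0n.
  by case/andP => /andP [].
(* With $L = \sqrt{L^2}$, it suffices that $L^2$ is a lower bound for the cost of every coupling. *)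
rewrite /W1 -[L](ger0_norm (ltW L0)) -sqrtr_sqr; apply: ler_wsqrtr.
apply: lb_le_inf.
  exists (complex.Re (\tr (cost FA FB *m (rho *t sigma)))).
  exists (rho *t sigma) => //.
  exact: coupling_tens hrho (density_separable sep).
move=> _ [S cS <-]; have [[Spsd _] _ _] := cS.
have c0 := cost_ge0 hFA hFB Spsd.
rewrite -[leRHS]sqr_sqrtr // ler_sqr ?nnegrE ?sqrtr_ge0 ?(ltW L0) //.
(* Clearing the positive denominator $2\sqrt{q}$ gives the estimate for a single coupling. *)
rewrite /L mul1r mulrC ler_pdivrMr ?mulr_gt0 ?sqrtr_gt0 // [leRHS]mulrC.
exact: (trnorm_correlation_le hFA hFB nA0 nB0 sep cS).
Qed.
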